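(* Let $P$ be a knot projection without 1-gons, and let $c$ be a crossing of $P$. If a set of $n$ regions of $P$ consisting of a $k_1$-gon, a $k_2$-gon, $\dots$, and a $k_n$-gon is an r-factor of $P^c$, then $$n \leq d(P) \leq k_1 + k_2 + \dots + k_n - n.$$
   Context: A knot projection $P$ is a projection of a knot on $S^2$ whose only self-intersections are transverse double points, called crossings; a knot diagram $D$ is a knot projection with over/under information at each crossing, and $|D|$ denotes the underlying projection. An edge is an arc from a crossing to the next crossing. A region is a connected component of the complement of the projection in $S^2$; a $k$-gon is a region whose boundary consists of $k$ edges and $k$ crossings. For an oriented knot diagram $D$ and a base point $b$ on an edge of $D$, a crossing $p$ is a warping crossing point of $D_b$ if, travelling along $D$ from $b$ in the given orientation, one encounters $p$ first as an under-crossing. The warping degree $d(D_b)$ is the number of warping crossing points of $D_b$, and $d(D)$ is the minimum of $d(D_b)$ over all base points $b$. The warping degree $d(P)$ of a knot projection $P$ is the minimum of $d(D)$ over both alternating knot diagrams $D$ with $|D|=P$ and both orientations. Regions are called disjoint when they share no crossings (on their boundaries). For a crossing $c$ of $P$, $P^c$ denotes the pair of $P$ and $c$. A set $S$ of regions of $P$ is an r-factor of $P^c$ when: (i) each crossing of $P$ except $c$ is on the boundary of one of the regions in $S$; (ii) the crossing $c$ is not on the boundary of any region in $S$; (iii) all the regions in $S$ are (pairwise) disjoint. *)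

(* Defs.v *)
From HB Require Import structures.
From mathcomp Require Import all_boot all_fingroup.

Set Implicit Arguments.
Unset Strict Implicit.
Unset Printing Implicit Defensive.

(* A projection with at least one crossing is encoded, up to a homeomorphism
   of the sphere preserving its orientation, by the combinatorial map it
   draws on S^2.  A dart is an edge with a chosen direction, and sits at the
   crossing where it starts; [e] reverses a dart, and [n] sends a dart to the
   next one counterclockwise around its crossing.
   Products of permutations are read from left to right. *)

(* Follow a dart to the next crossing and go straight on: x |-> n (n (e x)). *)
Definition straight (T : finType) (e n : {perm T}) : {perm T} := (e * n * n)%g.

(* Follow a dart to the next crossing and turn left, which keeps the region on
   the left-hand side unchanged: x |-> n^-1 (e x). *)
Definition leftmost (T : finType) (e n : {perm T}) : {perm T} := (e * n^-1)%g.

Record knot_projection := KnotProjection {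
  dart : finType;
  edge : {perm dart};
  node : {perm dart};
  edge2 : forall x, #|porbit edge x| = 2;
  (* crossings are double points *)
  node4 : forall x, #|porbit node x| = 4;
  (* the projection is that of a knot, not of a link: going straight on from
     any dart runs through every edge, in one of its two directions; in
     particular the map is connected *)
  one_curve : forall x y,
    (y \in porbit (straight edge node) x)
    || (edge y \in porbit (straight edge node) x);
  (* Euler's formula: the surface carrying the map is the sphere *)
  genus0 : #|porbits node| + #|porbits (leftmost edge node)|
           = #|porbits edge| + 2
}.

Section Projection.
Variable P : knot_projection.
Implicit Types (p c r : {set dart P}) (O : {set dart P}) (b x : dart P).

Definition crossings : {set {set dart P}} := porbits (node P).
Definition edges : {set {set dart P}} := porbits (edge P).
(* A region is the set of the darts that have it on their left. *)
Definition regions : {set {set dart P}} := porbits (leftmost (edge P) (node P)).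

Definition boundary_crossings r := [set p in crossings | ~~ [disjoint p & r]].
Definition boundary_edges r := [set a in edges | ~~ [disjoint a & r]].

Definition is_gon (k : nat) r : Prop :=
  [/\ r \in regions, #|boundary_edges r| = k & #|boundary_crossings r| = k].

Definition regions_disjoint r r' : Prop :=
  boundary_crossings r :&: boundary_crossings r' = set0.

Definition r_factor c (S : {set {set dart P}}) : Prop :=
  [/\ S \subset regions,
      forall p, p \in crossings -> p != c ->
        exists2 r, r \in S & p \in boundary_crossings r,
      forall r, r \in S -> c \notin boundary_crossings r
    & forall r r', r \in S -> r' \in S -> r != r' -> regions_disjoint r r'].

(* A diagram over P is the set O of the darts lying on the over-strand of
   their crossing: opposite darts n (n x) and x belong to the same strand,
   neighbouring darts n x and x to different ones. *)
Definition is_diagram O : bool := [forall x, (node P x \in O) == (x \notin O)].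

(* The two ends of every edge lie at different heights. *)
Definition alternating O : bool := [forall x, (edge P x \in O) == (x \notin O)].

(* The two orientations of the curve; each is the set of the darts that agree
   with it. *)
Definition orientations : {set {set dart P}} :=
  porbits (straight (edge P) (node P)).

(* A dart b stands for a base point on its edge together with the orientation
   of the curve given by b.  The curve enters the successive crossings
   opposite to the darts it follows, i.e. along their reverses; the list
   contains each passage exactly once. *)
Definition passages b : seq (dart P) :=
  [seq edge P x | x <- fingraph.orbit (straight (edge P) (node P)) b].

Definition warping_crossing O b p : bool :=
  if [seq x <- passages b | x \in p] is x :: _ then x \notin O else false.

Definition warping_degree_at O b : nat :=
  #|[set p in crossings | warping_crossing O b p]|.

(* In the two minima below the seed #|crossings| is an upper bound of all the
   values, so it does not affect the minimum of a nonempty family. *)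
Definition warping_degree_diagram O (o : {set dart P}) : nat :=
  \big[minn/#|crossings|]_(b in o) warping_degree_at O b.

Definition warping_degree : nat :=
  \big[minn/#|crossings|]_(O : {set dart P} | is_diagram O && alternating O)
    \big[minn/#|crossings|]_(o in orientations) warping_degree_diagram O o.

End Projection.

(* Main.v *)
Require Import Defs.
From HB Require Import structures.
From mathcomp Require Import all_boot all_fingroup all_algebra.
From mathcomp Require Import zify.

(** Let m be the number of crossings.

    An alternating diagram is the same thing as a checkerboard colouring of the
    regions, because a region sees its edges all run from over to under, or all
    from under to over.  Such a colouring exists on the sphere
    ([checkerboard], [alternating_diagram]): over F_2 the sets of edges that
    bound a set of regions form a space of dimension F - 1, the sets of edges
    that meet every crossing evenly form a space of dimension E - (V - 1), and
    Euler's formula makes the two equal; the set of all the edges belongs to the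
    second space since crossings have degree 4, so it bounds.

    Moving the base point of an alternating diagram over one crossing changes
    the status of that crossing only, so it adds 1 to the warping degree if the
    passage was an over-crossing and subtracts 1 otherwise.  The warping degrees
    of one oriented diagram thus take two consecutive values, the larger one at
    the base points that are followed by an under-crossing
    ([warping_degree_orbit]).

    Start just before the under-crossing at c.  Then c is a warping crossing.
    So is some crossing on the boundary of each region of the r-factor
    ([region_warping]): otherwise, with crossing passages dated by the order in
    which the curve makes them, every crossing of the region would be passed over
    before it is passed under, while the two ends of an edge of the region,
    one over and one under, are passed at consecutive dates, since the edge that
    carries the base point ends at c.  Looking at the latest date around the
    region then yields a crossing whose over- and under-passages are the two ends
    of one edge, that is a 1-gon.  As the regions are disjoint and avoid
    c, the warping degree at this base point is at least n + 1, hence it is at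
    least n at every base point, for every alternating diagram and orientation.

    Finally, exchanging over and under at all crossings turns the warping degree
    d at a base point into m - d ([warping_degree_at_compl]), so the opposite
    diagram reaches a value at most m - (n + 1), and m - 1 is at most the sum of
    the k_i because the regions cover all the crossings but c. *)

Set Implicit Arguments.
Unset Strict Implicit.
Unset Printing Implicit Defensive.

Import GRing.Theory.

(** * Orbits, lists and minima *)

Lemma porbit_step (T : finType) (s : {perm T}) x : porbit s (s x) = porbit s x.
Proof.
by apply/eqP; rewrite eq_porbit_mem; have:= mem_porbit s 1 x; rewrite expg1.
Qed.

Lemma porbits_meeting_set1 (A : finType) (t : {perm A}) (x : A) :
  [set p in porbits t | ~~ [disjoint p & [set x]]] = [set porbit t x].
Proof.
apply/setP=> p; rewrite !inE disjoint_sym disjoints1 negbK.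
apply/andP/eqP => [[/imsetP[y _ ->]]|->]; last by rewrite imset_f ?porbit_id.
by rewrite -eq_porbit_mem => /eqP->.
Qed.

Lemma porbit_fixed (T : finType) (t : {perm T}) x :
  t x = x -> porbit t x = [set x].
Proof.
move=> tx; apply/setP=> y; rewrite inE; apply/porbitP/eqP => [[i ->]|->].
  by elim: i => [|i IH]; rewrite ?expg0 ?perm1 // expgSr permM IH.
by exists 0; rewrite expg0 perm1.
Qed.

Section OrbitsOfSize2.
Variables (T : finType) (e : {perm T}).
Hypothesis e2 : forall x, #|porbit e x| = 2.

Lemma porbit_order2 x : porbit e x = [set x; e x].
Proof.
apply/eqP; rewrite eq_sym eqEcard; apply/andP; split.
  apply/subsetP=> y; rewrite !inE => /orP[]/eqP->; rewrite ?porbit_id //.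
  by have:= mem_porbit e 1 x; rewrite expg1.
rewrite e2 cards2; case: eqP => // /esym ex.
by have:= e2 x; rewrite porbit_fixed // cards1.
Qed.

Lemma perm_order2K x : e (e x) = x.
Proof.
have: e (e x) \in porbit e x by rewrite -permM (mem_porbit e 2).
rewrite porbit_order2 !inE => /orP[/eqP//|/eqP/perm_inj ex].
by have:= e2 x; rewrite porbit_order2 ex setUid cards1.
Qed.

End OrbitsOfSize2.

Lemma find_or (A : Type) (a1 a2 : pred A) l :
  find (fun x => a1 x || a2 x) l = minn (find a1 l) (find a2 l).
Proof.
elim: l => //= x l ->; case: (a1 x) => /=; first by rewrite min0n.
by case: (a2 x); rewrite ?minn0 ?minnSS.
Qed.

Lemma filter_find (A : Type) x0 (a : pred A) l :
  has a l -> filter a l = nth x0 l (find a l) :: filter a (drop (find a l).+1 l).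
Proof. by elim: l => //= x l IH; case: (a x); rewrite ?drop0. Qed.

(** The seed m need not be neutral for minn, so minn is no monoid law with unit m
    here and the minimum is bounded by induction on the enumeration. *)
Lemma big_minn_le (I : finType) (Q : pred I) (F : I -> nat) m i :
  Q i -> \big[minn/m]_(j | Q j) F j <= F i.
Proof.
move=> Qi; elim: (index_enum I) (mem_index_enum i) => // j l IH.
rewrite inE big_cons => /predU1P[<-|il]; first by rewrite Qi geq_minl.
by case: (Q j); rewrite ?geq_min ?IH ?orbT.
Qed.

Lemma leq_big_minn (I : finType) (Q : pred I) (F : I -> nat) m a :
  a <= m -> (forall i, Q i -> a <= F i) -> a <= \big[minn/m]_(i | Q i) F i.
Proof. by move=> am aF; elim/big_ind: _ => // x y; rewrite leq_min => -> ->. Qed.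

(** * Checkerboard colouring *)

Section OrbitIncidence.
Local Open Scope ring_scope.
Variables (T : finType) (s : {perm T}).

(** A row vector indexed by the orbits of s is a function on these orbits;
    multiplying it by orbit_mx reads it as a function on the points. *)
Definition orbit_mx : 'M['F_2]_(#|porbits s|, #|T|) :=
  \matrix_(i, j) (enum_val j \in (enum_val i : {set T}))%:R.

Definition orbit_index (x : T) : 'I_#|porbits s| :=
  enum_rank_in (imset_f (porbit s) (isT : x \in T)) (porbit s x).

Lemma enum_orbit_index x : enum_val (orbit_index x) = porbit s x.
Proof. by rewrite enum_rankK_in // imset_f. Qed.

Lemma mem_orbit_index x i : (x \in (enum_val i : {set T})) = (i == orbit_index x).
Proof.
apply/idP/eqP => [|->]; last by rewrite enum_orbit_index porbit_id.
have /imsetP[y _ Ey] := enum_valP i.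
move=> xi; apply: enum_val_inj; rewrite enum_orbit_index Ey.
by apply/esym/eqP; rewrite eq_porbit_mem -Ey.
Qed.

Lemma orbit_index_surj i : exists x, i = orbit_index x.
Proof.
have /imsetP[y _ Ey] := enum_valP i.
by exists y; apply: enum_val_inj; rewrite enum_orbit_index.
Qed.

Lemma orbit_index_perm x : orbit_index (s x) = orbit_index x.
Proof.
by apply: enum_val_inj; rewrite !enum_orbit_index porbit_step.
Qed.

Lemma mul_orbit_mx (v : 'rV_#|porbits s|) x :
  (v *m orbit_mx) 0 (enum_rank x) = v 0 (orbit_index x).
Proof.
rewrite mxE (bigD1 (orbit_index x)) //= big1 ?addr0 => [|i ni].
  by rewrite mxE enum_rankK mem_orbit_index eqxx mulr1.
by rewrite mxE enum_rankK mem_orbit_index (negbTE ni) mulr0.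
Qed.

End OrbitIncidence.

Section Checkerboard.
Local Open Scope ring_scope.
Variables (T : finType) (e : {perm T}).
Hypothesis e2 : forall x, #|porbit e x| = 2%N.

(** Coboundary matrix: e exchanges the two darts of an edge, and a function on the
    orbits of s is sent to the sums of its values at the two darts of each edge.
    For s = node this is the incidence matrix of crossings and edges, for
    s = leftmost that of regions and edges. *)
Definition edge_mx (s : {perm T}) := orbit_mx s *m (orbit_mx e)^T.

Lemma mul_edge_mx (s : {perm T}) (v : 'rV_#|porbits s|) x :
  (v *m edge_mx s) 0 (orbit_index e x)
  = v 0 (orbit_index s x) + v 0 (orbit_index s (e x)).
Proof.
rewrite mulmxA mxE.
rewrite (reindex (@enum_rank T)) /=; last first.
  by apply: onW_bij; apply: enum_rank_bij.
under eq_bigr => y _.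
  rewrite mul_orbit_mx !mxE enum_rankK enum_orbit_index; over.
rewrite (bigID (mem (porbit e x))) /= [X in _ + X]big1 ?addr0; last first.
  by move=> y /negbTE->; rewrite mulr0.
under eq_bigr => y -> do rewrite mulr1.
rewrite (porbit_order2 e2) big_setU1 ?big_set1 // inE.
by have:= e2 x; rewrite (porbit_order2 e2) cards2; case: eqP.
Qed.

(** The kernel of the coboundary consists of the functions that take the same
    value at both darts of every edge; by connectivity these are the constants, a
    space of dimension at most 1. *)
Lemma rank_edge_mx (s : {perm T}) :
  (forall (g : T -> 'F_2), (forall x, g (e x) = g x) ->
     (forall x, g (s x) = g x) -> forall x y, g x = g y) ->
  (#|porbits s| <= (\rank (edge_mx s)).+1)%N.
Proof.
move=> conn; rewrite -addn1 -leq_subLR -mxrank_ker.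
have rank1 := rank_leq_row (const_mx 1 : 'rV['F_2]_#|porbits s|).
apply: leq_trans rank1; apply: mxrankS.
apply/row_subP => i; set v := row i _.
have v0 : v *m edge_mx s = 0 by apply/sub_kermxP; exact: row_sub.
pose g x : 'F_2 := v 0 (orbit_index s x).
have ge : forall x, g (e x) = g x.
  move=> x; have := mul_edge_mx v x; rewrite v0 mxE => /esym/eqP.
  by rewrite addr_eq0 oppr_pchar2 ?pchar_Fp // => /eqP E; rewrite /g E.
have gs x : g (s x) = g x by rewrite /g orbit_index_perm.
suff ->: v = v 0 i *: const_mx 1 by exact: scalemx_sub.
apply/rowP => j; rewrite [RHS]mxE [const_mx _ _ _]mxE mulr1.
have [x ->] := orbit_index_surj j; have [y ->] := orbit_index_surj i.
exact: conn g ge gs x y.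
Qed.

Variable n : {perm T}.
Let f := leftmost e n.
Hypothesis n4 : forall x, #|porbit n x| = 4%N.
Hypothesis conn : forall g : T -> 'F_2, (forall x, g (e x) = g x) ->
     (forall x, g (n x) = g x) -> forall x y, g x = g y.
Hypothesis euler : (#|porbits n| + #|porbits f| = #|porbits e| + 2)%N.

(** The boundary of a region meets every crossing evenly: each dart x of the
    region that starts at a crossing is followed, around that crossing, by the
    reverse of the dart that comes before x along the boundary, so that the ends
    of the boundary edges at a crossing come in pairs. *)
Lemma face_boundary_cycle : edge_mx f *m (edge_mx n)^T = 0.
Proof.
apply/row_matrixP=> i; rewrite row0; apply/rowP=> j; rewrite rowE [RHS]mxE.
rewrite /edge_mx trmx_mul trmxK !mulmxA.
set u := delta_mx 0 i.
have uf x : u 0 (orbit_index f (f x)) = u 0 (orbit_index f x).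
  by rewrite orbit_index_perm.
rewrite mxE (reindex (@enum_rank T)) /=; last first.
  by apply: onW_bij; apply: enum_rank_bij.
pose h x : 'F_2 := (x \in (enum_val j : {set T}))%:R.
have hn x : h (n x) = h x by rewrite /h !mem_orbit_index orbit_index_perm.
under eq_bigr => x _.
  rewrite mul_orbit_mx -mulmxA mul_edge_mx mulrDl [(orbit_mx n)^T _ _]mxE.
  rewrite [orbit_mx n _ _]mxE enum_rankK -/(h x).
  over.
(* The part of the sum that looks at e x, shifted first by e and then along the
   region by f, becomes equal to the other part; both cancel in F_2. *)
rewrite big_split /= [X in _ + X](reindex_inj (@perm_inj _ e)) /=.
under [X in _ + X]eq_bigr => x _.
  rewrite (perm_order2K e2) -uf -[h (e x)](_ : h (f x) = _); last first.
    by rewrite -hn permM permKV.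
  over.
rewrite -[X in _ + X](reindex_inj (@perm_inj _ f) (P := xpredT)
  (F := fun x => u 0 (orbit_index f x) * h x)) /=.
by rewrite addrr_pchar2 // pchar_Fp.
Qed.

(** Each crossing is met by the set of all edges 4 times, an even number. *)
Lemma ones_cycle : (const_mx 1 : 'rV_#|porbits e|) *m (edge_mx n)^T = 0.
Proof.
rewrite trmx_mul trmxK mulmxA; apply/rowP=> j.
rewrite mxE (reindex (@enum_rank T)) /=; last first.
  by apply: onW_bij; apply: enum_rank_bij.
under eq_bigr => x _ do rewrite mul_orbit_mx !mxE enum_rankK mul1r.
have /imsetP[y _ Ey] := enum_valP j.
under eq_bigr => x _ do rewrite Ey mulrb.
rewrite -big_mkcond sumr_const n4 mxE.
by apply/eqP.
Qed.

(** Boundaries of sets of regions are among the edge sets that meet every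
    crossing evenly, and Euler's formula says that the dimensions agree; hence
    the set of all edges is the boundary of a set of regions, and membership in
    that set changes across every edge and at every step around a crossing. *)
Lemma checkerboard : exists g : T -> bool,
  (forall x, g (e x) = ~~ g x) /\ (forall x, g (n x) = ~~ g x).
Proof.
have rn := rank_edge_mx conn.
have rf : (#|porbits f| <= (\rank (edge_mx f)).+1)%N.
  apply: rank_edge_mx => g ge gf; apply: conn => // x.
  by rewrite -[LHS]ge -[LHS]gf permM (perm_order2K e2) permK.
have sub : (edge_mx f <= kermx (edge_mx n)^T)%MS.
  exact/sub_kermxP/face_boundary_cycle.
have /submxP[v Ev] : ((const_mx 1 : 'rV_#|porbits e|) <= edge_mx f)%MS.
  have: (kermx (edge_mx n)^T <= edge_mx f)%MS.
    rewrite -(geq_leqif (mxrank_leqif_sup sub)) mxrank_ker mxrank_tr; lia.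
  by apply: submx_trans; exact/sub_kermxP/ones_cycle.
pose g x := v 0 (orbit_index f x) == 1.
have ge x : g (e x) = ~~ g x.
  have := mul_edge_mx v x; rewrite -Ev mxE /g => /esym.
  move: (v 0 _) (v 0 _) => a b.
  by case: a => [[|[|]]] //=; case: b => [[|[|]]].
have gf x : g (f x) = g x by rewrite /g orbit_index_perm.
exists g; split=> // x.
have fen : f (e (n x)) = x by rewrite permM (perm_order2K e2) permK.
by rewrite -{2}fen gf ge negbK.
Qed.
End Checkerboard.

(** * Dates of the passages *)

Section Curve.
Variable P : knot_projection.
Local Notation e := (edge P).
Local Notation n := (node P).
Local Notation s := (straight (edge P) (node P)).
Local Notation f := (leftmost (edge P) (node P)).
Implicit Types (x y b : dart P) (i j : nat).

Lemma edgeK x : e (e x) = x. Proof. exact: perm_order2K (@edge2 P) x. Qed.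

Lemma edge_neq x : e x != x.
Proof.
have := edge2 x; rewrite (porbit_order2 (@edge2 P)) cards2 eq_sym.
by case: eqP.
Qed.

Lemma porbit_node x : porbit n x = [set x; n x; n (n x); n (n (n x))].
Proof.
by apply/setP=> y; rewrite porbit_traject node4 /= !inE -!orbA.
Qed.

Lemma node_uniq x : uniq [:: x; n x; n (n x); n (n (n x))].
Proof. by have := uniq_traject_porbit n x; rewrite node4. Qed.

Lemma nodeK x : n (n (n (n x))) = x.
Proof. by have := iter_porbit n x; rewrite node4. Qed.

Lemma node2_neq x : n (n x) != x.
Proof.
apply/eqP => nnx; have := node_uniq x.
by rewrite nnx /= !inE eqxx !orbT.
Qed.

Lemma straightE x : s x = n (n (e x)). Proof. by rewrite !permM. Qed.

Lemma leftmostE x : n (f x) = e x. Proof. by rewrite permM permKV. Qed.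

Lemma edge_straight x : s (e (s x)) = e x.
Proof. by rewrite !straightE edgeK nodeK. Qed.

Lemma iter_straight i x : (s ^+ i)%g x = iter i s x.
Proof. by rewrite permX. Qed.

(** Reversal runs the curve backwards, so if e x = s^(i+2) x then
    e (s x) = s^i (s x); the induction ends with a dart fixed by e or by n n. *)
Lemma no_reversal i x : e x != iter i s x.
Proof.
elim/ltn_ind: i x => -[|[|i]] IH x /=.
- exact: edge_neq.
- by rewrite straightE eq_sym node2_neq.
apply: contra_neq (IH i (ltnW (ltnSn _)) (s x)) => ex.
by apply: (@perm_inj _ s); rewrite edge_straight ex -!iterS -iterSr.
Qed.

Lemma mem_straightP x y : reflect (exists i, y = iter i s x) (y \in porbit s x).
Proof.
apply: (iffP (porbitP _ _ _)) => -[i ->]; exists i; by rewrite iter_straight.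
Qed.

(** The curve has exactly two orientations, exchanged by e. *)
Lemma edge_porbit_straight x y :
  (e y \in porbit s x) = (y \notin porbit s x).
Proof.
have := one_curve x y; case: (boolP (y \in _)) => //= yx _.
apply/negP; move: yx; rewrite -eq_porbit_mem => /eqP<-.
by case/mem_straightP => i /eqP; rewrite (negbTE (no_reversal _ _)).
Qed.

Lemma mem_orbit_straight b x : (x \in fingraph.orbit s b) = (x \in porbit s b).
Proof.
rewrite -fconnect_orbit; apply/idP/mem_straightP => [/iter_findex <-|[i ->]].
  by eexists.
exact: fconnect_iter.
Qed.

Lemma mem_passages b x : (x \in passages b) = (x \notin porbit s b).
Proof.
rewrite -edge_porbit_straight -mem_orbit_straight -{1}[x]edgeK mem_map //.
exact: perm_inj.
Qed.

Lemma passages_uniq b : uniq (passages b).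
Proof. by rewrite map_inj_uniq ?orbit_uniq //; exact: perm_inj. Qed.

Lemma opposite_passage b x : (n (n x) \in passages b) = (x \notin passages b).
Proof.
rewrite !mem_passages -edge_porbit_straight negbK.
have sennx : s (e (n (n x))) = x by rewrite straightE edgeK nodeK.
by rewrite -{2}sennx porbit_sym [RHS]porbit_sym porbit_step.
Qed.

(** The date at which the curve started at b runs along the strand through the
    crossing of x that contains x.  Of the two opposite darts x and n (n x) of
    that strand, only the one opposed to the orientation is a passage, which is
    why both are looked for. *)
Definition strand_time b x : nat := find (pred2 x (n (n x))) (passages b).
Local Notation T := strand_time.

Lemma strand_time_opposite b x : T b (n (n x)) = T b x.
Proof. by apply: eq_find => y /=; rewrite nodeK orbC. Qed.

Lemma strand_passed b x : has (pred2 x (n (n x))) (passages b).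
Proof.
apply/hasP; case: (boolP (x \in passages b)) => [xb|].
  by exists x; rewrite //= eqxx.
by rewrite -opposite_passage => xb; exists (n (n x)); rewrite //= eqxx orbT.
Qed.

Lemma strand_time_inj b x y : T b x = T b y -> y = x \/ y = n (n x).
Proof.
move=> Txy.
have := nth_find x (strand_passed b x); have := nth_find x (strand_passed b y).
rewrite -!/(T _ _) Txy; move: (nth _ _ _) => z /= /orP[]/eqP-> /orP[]/eqP; auto.
  by move=> <-; rewrite nodeK; auto.
by move/perm_inj/perm_inj; auto.
Qed.

Lemma strand_time_passage b i :
  i < fingraph.order s b -> T b (e (iter i s b)) = i.
Proof.
move=> lt_i.
have si : i < size (passages b) by rewrite size_map fingraph.size_orbit.
have Ei : nth b (passages b) i = e (iter i s b).
  by rewrite (nth_map b) ?fingraph.size_orbit // nth_traject.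
have := nth_find b (strand_passed b (e (iter i s b))).
rewrite -/(T _ _) => /orP[/eqP E|/eqP E].
  apply/eqP; rewrite -(nth_uniq b _ si (passages_uniq b)) ?Ei ?E //.
  by rewrite -has_find strand_passed.
have: n (n (e (iter i s b))) \in passages b.
  by rewrite -E mem_nth // -has_find strand_passed.
by rewrite opposite_passage -Ei mem_nth.
Qed.

Lemma strand_time_next b x : x \in porbit s b -> x != b ->
  T b (e x) = (T b x).+1.
Proof.
rewrite -mem_orbit_straight => /trajectP[[|i] lt_i ->]; first by rewrite eqxx.
move=> _; rewrite strand_time_passage //= {1}straightE.
by rewrite strand_time_opposite strand_time_passage // ltnW.
Qed.

(** The edge that contains the base point is excluded: its ends have the first
    and the last dates. *)
Lemma strand_time_edge b x : x != b -> e x != b ->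
  T b (e x) = (T b x).+1 \/ T b x = (T b (e x)).+1.
Proof.
move=> xb exb; case: (boolP (x \in porbit s b)) => xo.
  by left; exact: strand_time_next.
by right; rewrite -{1}[x]edgeK strand_time_next ?edge_porbit_straight.
Qed.

End Curve.

(** * Warping crossings *)

Section Warping.
Variable P : knot_projection.
Local Notation e := (edge P).
Local Notation n := (node P).
Local Notation s := (straight (edge P) (node P)).
Local Notation T := (@strand_time P).
Implicit Types (x y b : dart P) (i j : nat).

Lemma diagram_node O : is_diagram O -> forall x, (n x \in O) = (x \notin O).
Proof. by move=> /forallP h x; apply/eqP. Qed.

Lemma alternating_edge O : alternating O -> forall x, (e x \in O) = (x \notin O).
Proof. by move=> /forallP h x; apply/eqP. Qed.

(** In a checkerboard colouring, the darts that have a black region on their left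
    form an alternating diagram. *)
Lemma alternating_diagram :
  exists2 O : {set dart P}, is_diagram O & alternating O.
Proof.
have conn (g : dart P -> 'F_2) : (forall x, g (e x) = g x) ->
    (forall x, g (n x) = g x) -> forall x y, g x = g y.
  move=> ge gn x y.
  have gs z : g (s z) = g z by rewrite straightE !gn ge.
  have gi i : g (iter i s x) = g x by elim: i => //= i <-.
  by case/orP: (one_curve x y) => /mem_straightP[i E]; rewrite -(gi i) -E ?ge.
have [g [ge gn]] := checkerboard (@edge2 P) (@node4 P) conn (genus0 P).
by exists [set x | g x]; apply/forallP => x; rewrite !inE ?gn ?ge.
Qed.

Variable O : {set dart P}.
Hypothesis diagO : is_diagram O.
Let On := diagram_node diagO.

(** The two strands of the crossing of y are those of y and of n y, so only the
    order of their dates matters. *)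
Lemma warping_time b y : warping_crossing O b (porbit n y) =
  if T b y < T b (n y) then y \notin O else y \in O.
Proof.
pose a1 := pred2 y (n (n y)); pose a2 := pred2 (n y) (n (n (n y))).
rewrite /warping_crossing (@eq_filter _ _ (fun x => a1 x || a2 x)); last first.
  by move=> x; rewrite porbit_node !inE /= -!orbA; congr (_ || _); rewrite orbCA.
have p1 := strand_passed b y; have p2 := strand_passed b (n y).
rewrite (filter_find b); last by apply: sub_has p1 => x /= ->.
rewrite find_or -/(T b y) -/(T b (n y)) /minn.
case: ltnP => _.
  by case/orP: (nth_find b p1) => /eqP; rewrite -/(T b y) => ->;
     rewrite ?On ?negbK.
by case/orP: (nth_find b p2) => /eqP; rewrite -/(T b (n y)) => ->;
   rewrite !On !negbK.
Qed.

Hypothesis altO : alternating O.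
Let Oe := alternating_edge altO.

Lemma alternating_straight x : (s x \in O) = (x \notin O).
Proof. by rewrite straightE !On Oe negbK. Qed.

Lemma passages_straight b :
  exists l, passages b = e b :: l /\ passages (s b) = rcons l (e b).
Proof.
have sinj : injective s by exact: perm_inj.
rewrite /passages /fingraph.orbit.
have /(orbitPcycle 0 1) /= -> := fingraph.cycle_orbit sinj b.
have := fingraph.iter_order sinj b; have := fingraph.order_gt0 s b.
case: (fingraph.order s b) => // m _ itb.
exists [seq e x | x <- traject s (s b) m]; split; first by rewrite trajectS.
by rewrite trajectSr -iterSr itb map_rcons.
Qed.

(** Moving the base point over one crossing postpones the passage e b from the
    first to the last place.  At the crossing of e b the other strand now comes
    first, and it is an under-strand exactly when e b is over; the order of the
    passages at any other crossing is unchanged. *)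
Lemma warping_straight b p : p \in crossings P ->
  warping_crossing O (s b) p =
  if e b \in p then e b \in O else warping_crossing O b p.
Proof.
case/imsetP=> z _ ->{p}; have [l [Eb Esb]] := passages_straight b.
case: ifP => [eb|neb]; last first.
  by rewrite /warping_crossing Eb Esb filter_rcons /= neb.
have -> : porbit n z = porbit n (e b) by apply/esym/eqP; rewrite eq_porbit_mem.
rewrite warping_time; suff -> : T (s b) (e b) < T (s b) (n (e b)) = false by [].
apply/negbTE; rewrite -leqNgt.
have ub := passages_uniq (s b).
rewrite Esb rcons_uniq in ub; case/andP: ub => ebl _.
have h : has (pred2 (n (e b)) (n (n (n (e b))))) l.
  have := strand_passed (s b) (n (e b)); rewrite Esb has_rcons /=.
  have := node_uniq (e b); rewrite /= !inE !negb_or.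
  by case/andP=> /and3P[/negbTE-> _ /negbTE->].
have [Tn Te]: T (s b) (n (e b)) < size l /\ T (s b) (e b) = size l.
  rewrite /strand_time Esb -cats1 !find_cat h -has_find h; split=> //.
  rewrite ifN /= ?eqxx ?addn0 //.
  apply/hasPn => x xl /=; rewrite negb_or.
  have xb : x \in passages b by rewrite Eb inE xl orbT.
  apply/andP; split; first by apply: contraNneq ebl => <-.
  apply: contraTneq xb => ->; rewrite opposite_passage Eb inE eqxx //.
by rewrite Te ltnW.
Qed.

Lemma warping_at_base b : warping_crossing O b (porbit n (e b)) = (e b \notin O).
Proof.
have [l [Eb _]] := passages_straight b.
by rewrite /warping_crossing Eb /= porbit_id.
Qed.

Lemma warping_degree_straight b :
  warping_degree_at O (s b) + (s b \notin O) = warping_degree_at O b + (b \notin O).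
Proof.
rewrite alternating_straight negbK /warping_degree_at.
rewrite !(cardsD1 (porbit n (e b)) [set p in _ | _]) !inE imset_f //.
rewrite warping_straight ?imset_f // porbit_id warping_at_base Oe negbK.
set A := _ :\ _; set B := _ :\ _; suff -> : A = B.
  by case: (b \in O) => /=; lia.
apply/setP=> p; rewrite !inE; case: (altP (p =P _)) => //= np.
case: (boolP (p \in crossings P)) => //= cp; rewrite warping_straight // ifN //.
apply: contra np; case/imsetP: cp => z _ ->; rewrite -eq_porbit_mem.
by move/eqP->.
Qed.

(** The passage that follows the base point b is under exactly when b lies in O,
    as the two ends of the edge of b have different heights: the warping degree
    at such a b exceeds by 1 the one at the other base points. *)
Lemma warping_degree_orbit b b' : b' \in porbit s b ->
  warping_degree_at O b' + (b' \notin O) = warping_degree_at O b + (b \notin O).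
Proof.
case/mem_straightP=> i ->; elim: i => //= i <-.
exact: warping_degree_straight.
Qed.

End Warping.

(** * Regions *)

Section Regions.
Variable P : knot_projection.
Local Notation e := (edge P).
Local Notation n := (node P).
Local Notation f := (leftmost (edge P) (node P)).
Local Notation T := (@strand_time P).
Implicit Types (x y b : dart P).

(** A dart followed by itself along its region is a loop that bounds it. *)
Lemma fixed_dart_1gon x : f x = x -> is_gon 1 (porbit f x).
Proof.
move=> /porbit_fixed ox.
split; first exact: imset_f.
- by rewrite /boundary_edges ox porbits_meeting_set1 cards1.
- by rewrite /boundary_crossings ox porbits_meeting_set1 cards1.
Qed.

(** A loop whose ends are neighbours around their crossing bounds a 1-gon on the
    side of the corner between its two ends. *)
Lemma no_loop : (forall r : {set dart P}, ~ is_gon 1 r) ->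
  forall x, e x <> n x /\ e x <> n (n (n x)).
Proof.
move=> no_1gon x; split=> ex.
  apply: (no_1gon (porbit f x)); apply: fixed_dart_1gon.
  by apply: (@perm_inj _ n); rewrite leftmostE.
apply: (no_1gon (porbit f (e x))); apply: fixed_dart_1gon.
by apply: (@perm_inj _ n); rewrite leftmostE edgeK ex nodeK.
Qed.

Lemma strand_time_node b x : T b x != T b (n x).
Proof.
have := node_uniq x; rewrite /= inE negb_or eq_sym => /andP[/andP[/eqP nx _] _].
by apply/eqP=> /strand_time_inj[|/perm_inj/esym].
Qed.

Variable O : {set dart P}.
Hypotheses (diagO : is_diagram O) (altO : alternating O).
Let On := diagram_node diagO.
Let Oe := alternating_edge altO.

(** Along a region of an alternating diagram, either all the darts start over or
    all start under.  If every crossing were passed over before under, then in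
    the first case the dart arriving at the latest under-passage would leave an
    over-passage made just before; the under-passage there comes after this
    over-passage and not after the latest one, so it is the latest one, and the
    dart is a loop.  In the second case the dart that leaves the latest
    under-passage plays the same role. *)
Lemma region_warping b r : (forall x, e x <> n x /\ e x <> n (n (n x))) ->
  r \in regions P -> porbit n (e b) \notin boundary_crossings r ->
  exists2 p, p \in boundary_crossings r & warping_crossing O b p.
Proof.
move=> noloop /imsetP[x0 _ Er] br.
case: (pickP [pred p in boundary_crossings r | warping_crossing O b p]).
  by move=> p /andP[]; exists p.
move=> nowarp; exfalso.
have bc x : x \in r -> porbit n x \in boundary_crossings r.
  move=> xr; rewrite inE imset_f //=; apply/pred0Pn; exists x.
  by rewrite /= porbit_id.
have fr x : (f x \in r) = (x \in r).
  by rewrite Er porbit_sym porbit_step porbit_sym.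
(* The edge that carries the base point is not on the boundary of r, because it
   ends at the crossing of e b. *)
have xneb x : x \in r -> x != e b.
  by apply: contraTneq => ->; apply: contra br; exact: bc.
have xnb x : x \in r -> x != b.
  rewrite -fr; apply: contraTneq => ->; apply: contra br => /bc.
  by rewrite -porbit_step leftmostE.
have Tedge x : x \in r -> T b (e x) = (T b x).+1 \/ T b x = (T b (e x)).+1.
  move=> xr; apply: strand_time_edge; first exact: xnb.
  by apply: contra (xneb x xr) => /eqP <-; rewrite edgeK.
have fO x : (f x \in O) = (x \in O).
  by rewrite -[RHS]negbK -Oe -leftmostE On negbK.
have rO x : x \in r -> (x \in O) = (x0 \in O).
  rewrite Er => /porbitP[i ->].
  by elim: i => [|i IH]; rewrite ?expg0 ?perm1 // expgSr permM fO.
have Tx x : x \in r -> (x \in O) = (T b x < T b (n x)).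
  move=> xr; have := nowarp (porbit n x); rewrite /= bc //= warping_time //.
  by case: ltnP => _; case: (x \in O).
have noT x : T b (n x) <> T b (e x).
  by have [n1 n2] := noloop x; case/strand_time_inj.
have x0r : x0 \in r by rewrite Er porbit_id.
case: (boolP (x0 \in O)) => x0O.
  case: (@arg_maxnP _ x0 (mem r) (fun x => T b (n x)) x0r) => y yr ymax.
  pose z := (f^-1)%g y; have fz : f z = y by rewrite permKV.
  have zr : z \in r by rewrite -fr fz.
  have := ymax z zr; rewrite /= -{1}fz leftmostE.
  have := Tx z zr; rewrite rO // x0O => /esym.
  have := noT z; have := Tedge z zr; lia.
case: (@arg_maxnP _ x0 (mem r) (fun x => T b x) x0r) => y yr ymax.
have fyr : f y \in r by rewrite fr.
have noT' : T b (f y) <> T b y.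
  have [n1 n2] := noloop y; case/esym/strand_time_inj => E.
    by apply: n1; rewrite -leftmostE E.
  by apply: n2; rewrite -leftmostE E.
have := Tx _ fyr; rewrite rO // (negbTE x0O) leftmostE.
have := ymax _ fyr; have := Tedge y yr; have := strand_time_node b (f y).
rewrite leftmostE /=; lia.
Qed.

End Regions.

(** * Base point and mirror image *)

Section BasePointAndMirror.
Variable P : knot_projection.
Local Notation e := (edge P).
Local Notation n := (node P).
Local Notation s := (straight (edge P) (node P)).

Lemma warping_crossing_compl (O : {set dart P}) b p :
  is_diagram O -> p \in crossings P ->
  warping_crossing (~: O) b p = ~~ warping_crossing O b p.
Proof.
move=> diagO; case/imsetP=> z _ ->.
have diagC : is_diagram (~: O).
  by apply/forallP=> x; rewrite !inE (diagram_node diagO).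
by rewrite !warping_time // !inE; case: ifP.
Qed.

Lemma warping_degree_at_compl (O : {set dart P}) b : is_diagram O ->
  warping_degree_at O b + warping_degree_at (~: O) b = #|crossings P|.
Proof.
move=> diagO; rewrite -(cardsID [set p | warping_crossing O b p] (crossings P)).
congr (_ + _); apply: eq_card => p; rewrite !inE //.
rewrite [RHS]andbC; case: (boolP (p \in crossings P)) => //= cp.
by rewrite warping_crossing_compl.
Qed.

(** The under-strand of c is run along in the orientation of b by exactly one of
    its two darts y and n (n y); the base point is put just before it. *)
Lemma start_under (O : {set dart P}) b c :
  is_diagram O -> alternating O -> c \in crossings P ->
  exists b0, [/\ b0 \in porbit s b, b0 \in O & c = porbit n (e b0)].
Proof.
move=> diagO altO /imsetP[z _ ->].
have [y yO ->] : exists2 y, y \notin O & porbit n z = porbit n y.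
  case: (boolP (z \in O)) => zO; last by exists z.
  by exists (n z); rewrite ?(diagram_node diagO) ?negbK // porbit_step.
case: (boolP (e y \in porbit s b)) => eyb.
  by exists (e y); rewrite eyb edgeK (alternating_edge altO).
exists (e (n (n y))).
rewrite edgeK (alternating_edge altO) !(diagram_node diagO) negbK.
rewrite !porbit_step yO; split=> //.
rewrite porbit_sym -porbit_step straightE edgeK nodeK porbit_sym.
by rewrite edge_porbit_straight negbK in eyb.
Qed.

End BasePointAndMirror.

(** * The bounds *)

Theorem theorem4p1 (P : knot_projection) (c : {set dart P})
    (no_1gon : forall r : {set dart P}, ~ is_gon 1 r)
    (c_crossing : c \in crossings P)
    (n : nat) (k : 'I_n -> nat) (R : 'I_n -> {set dart P})
    (R_distinct : injective R)
    (R_gon : forall i : 'I_n, is_gon (k i) (R i))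
    (R_factor : r_factor c [set R i | i : 'I_n]) :
  n <= warping_degree P /\ warping_degree P <= (\sum_(i < n) k i) - n.
Proof.
case: R_factor => [_ cover_c avoid_c disj].
(* The n regions have distinct warping crossings, and c is one more. *)
have start_c O b0 : is_diagram O -> alternating O -> b0 \in O ->
    c = porbit (node P) (edge P b0) -> n < warping_degree_at O b0.
  move=> diagO altO b0O Ec.
  have warpR i : {p | p \in boundary_crossings (R i) & warping_crossing O b0 p}.
    apply/sig2_eqW/(region_warping diagO altO (no_loop no_1gon)).
      by case: (R_gon i).
    by rewrite -Ec; apply: avoid_c; exact: imset_f.
  pose w i := s2val (warpR i).
  have wR i : w i \in boundary_crossings (R i) := s2valP (warpR i).
  have w_inj : injective w.
    move=> i j wij; apply: R_distinct; apply/eqP/negPn/negP => nij.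
    have := disj _ _ (imset_f R (isT : i \in 'I_n)) (imset_f R (isT : j \in 'I_n)).
    move/(_ nij).
    by move/setP/(_ (w i)); rewrite in_setI wR wij wR in_set0.
  rewrite -{1}(card_ord n) -(card_imset _ w_inj) /warping_degree_at.
  apply: proper_card; apply/properP; split.
    apply/subsetP=> _ /imsetP[i _ ->]; rewrite inE.
    have := wR i; rewrite inE => /andP[-> _] /=.
    exact: s2valP' (warpR i).
  exists c.
    by rewrite inE c_crossing Ec warping_at_base // (alternating_edge altO) b0O.
  apply/imsetP=> -[i _ Ec']; have := avoid_c _ (imset_f R (isT : i \in 'I_n)).
  by rewrite Ec' wR.
have [O diagO altO] := alternating_diagram P.
have degree_ge (O' : {set dart P}) b : is_diagram O' -> alternating O' ->
    n <= warping_degree_at O' b.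
  move=> diagO' altO'.
  have [b0 [b0b b0O Ec]] := start_under b diagO' altO' c_crossing.
  have := start_c _ _ diagO' altO' b0O Ec.
  have := warping_degree_orbit diagO' altO' b0b; rewrite b0O.
  by case: (b \in O') => /=; lia.
have [x0 _ _] := imsetP c_crossing.
have n_crossings : n <= #|crossings P|.
  apply: leq_trans (degree_ge O x0 diagO altO) _; apply: subset_leq_card.
  by apply/subsetP=> p; rewrite inE => /andP[].
split.
  apply: leq_big_minn => // O' /andP[diagO' altO'].
  apply: leq_big_minn => // o _; apply: leq_big_minn => // b _.
  exact: degree_ge.
(* For the upper bound, exchange over and under at all the crossings. *)
have [b0 [_ b0O Ec]] := start_under x0 diagO altO c_crossing.
have hn := start_c _ _ diagO altO b0O Ec.
have hm := warping_degree_at_compl b0 diagO.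
have le_d : warping_degree P <= warping_degree_at (~: O) b0.
  have diagC : is_diagram (~: O).
    by apply/forallP=> x; rewrite !inE (diagram_node diagO).
  have altC : alternating (~: O).
    by apply/forallP=> x; rewrite !inE (alternating_edge altO).
  apply: leq_trans (big_minn_le _ _ (i := ~: O) _) _.
    by rewrite diagC altC.
  have b0_orient : porbit (straight (edge P) (node P)) b0 \in orientations P.
    exact: imset_f.
  apply: leq_trans (big_minn_le _ _ b0_orient) _.
  by apply: big_minn_le; exact: porbit_id.
have le_k : #|crossings P| <= (\sum_(i < n) k i).+1.
  rewrite (cardsD1 c) c_crossing add1n ltnS.
  have -> : \sum_(i < n) k i = \sum_(i < n) #|boundary_crossings (R i)|.
    by apply: eq_bigr => i _; case: (R_gon i).
  apply: (@leq_trans #|\bigcup_(i < n) boundary_crossings (R i)|).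
    apply: subset_leq_card; apply/subsetP=> p; rewrite !inE => /andP[pc cp].
    have [_ /imsetP[i _ ->] pi] := cover_c p cp pc.
    by apply/bigcupP; exists i.
  elim/big_rec2: _ => [|i m A _ IH]; first by rewrite cards0.
  by apply: leq_trans (leq_card_setU _ _) _; rewrite leq_add2l.
lia.
Qed.
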